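(* Consider the ACK-Group random multiple access scheme with $r$ device groups $\mathcal{C}_1,\dots,\mathcal{C}_r$, in which devices of $\mathcal{C}_i$ transmit only in subframe $i$ with parameter $g_i^{(i)}>0$, in the large-system limit (all as defined in the context). For $1\le i\le r$, the probability $\epsilon_i^{(i)}$ that a device from the group $\mathcal{C}_i$ remains unresolved at the end of subframe $i$ is $$\epsilon_i^{(i)}=\lim_{\ell\to\infty}q_i[\ell],$$ where $q_i[0]=1$ and, for $\ell\ge 1$, $$q_i[\ell]=\lambda_i^{(i)}\left(1-\omega_i^{(i)}\left(1-q_i[\ell-1]\right)\right),$$ with $$\lambda_i^{(s)}(x)=\frac{\sum_d d\,\Lambda_{i,d}^{(s)}x^{d-1}}{\sum_d d\,\Lambda_{i,d}^{(s)}},\qquad \omega_i^{(s)}(x)=\frac{\sum_d d\,\Omega_{i,d}^{(s)}x^{d-1}}{\sum_d d\,\Omega_{i,d}^{(s)}},$$ where $\Lambda_{i,d}^{(s)}$ and $\Omega_{i,d}^{(s)}$ are the Poisson degree distributions given in the context.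
   Context: **Model (ACK-Group scheme).** There are $K$ devices partitioned into groups $\mathcal{C}_1,\dots,\mathcal{C}_r$ with $|\mathcal{C}_i|=\alpha_iK$ (up to rounding), $0<\alpha_i<1$, $\sum_i\alpha_i=1$. A transmission frame consists of $r$ consecutive subframes, subframe $s$ having $\Delta N_s$ time slots. Devices of $\mathcal{C}_i$ are silent outside subframe $i$; in each slot of subframe $i$ each device of $\mathcal{C}_i$ transmits a copy of its packet independently with probability $p_i^{(i)}=g_i^{(i)}/|\mathcal{C}_i|$, where $0<g_i^{(i)}\le|\mathcal{C}_i|$. **Successive interference cancellation (SIC).** At the end of subframe $i$ the receiver runs SIC iterations: in each iteration, every slot in which exactly one not-yet-resolved device transmitted resolves that device, and all copies of the packets of resolved devices are then removed from all slots. **Large-system limit.** The ratios $\alpha_i$ and $\nu_s=\Delta N_s/K>0$ and the numbers $g_i^{(i)}$ are fixed and $K\to\infty$. Here $\epsilon_i^{(i)}$ denotes the limiting average fraction of devices of $\mathcal{C}_i$ that are unresolved at the end of subframe $i$ (equivalently the limiting probability that a given device of $\mathcal{C}_i$ is unresolved), where first $K\to\infty$ with a fixed number $\ell$ of SIC iterations and then $\ell\to\infty$. **Degree distributions.** In the limit, the number $d$ of slots of subframe $i$ selected by a device of $\mathcal{C}_i$ has the Poisson distribution $\Lambda_{i,d}^{(i)}=\frac{(\zeta_i^{(i)})^d e^{-\zeta_i^{(i)}}}{d!}$ with $\zeta_i^{(i)}=g_i^{(i)}\Delta N_i/|\mathcal{C}_i|=g_i^{(i)}\nu_i/\alpha_i$,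 and the number $d$ of devices of $\mathcal{C}_i$ transmitting in a given slot of subframe $i$ has the Poisson distribution $\Omega_{i,d}^{(i)}=\frac{(g_i^{(i)})^d e^{-g_i^{(i)}}}{d!}$. *)

(* Defs.v *)
From HB Require Import structures.
From mathcomp Require Import all_boot all_order all_algebra.
From mathcomp Require Import all_classical all_reals all_analysis.

Set Implicit Arguments.
Unset Strict Implicit.
Unset Printing Implicit Defensive.

Import Order.TTheory GRing.Theory Num.Theory.
Import numFieldNormedType.Exports.

Local Open Scope ring_scope.

(* A slot of the frame is a pair (subframe s, slot index t < N s). *)
Definition slot (r : nat) (N : 'I_r -> nat) : finType := {s : 'I_r & 'I_(N s)}.

(* x (k, t) holds iff device k transmits in slot t. *)
Definition frame (K r : nat) (N : 'I_r -> nat) : finType :=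
  {ffun 'I_K * slot N -> bool}.

Definition group (K r : nat) (grp : 'I_K -> 'I_r) (i : 'I_r) : {set 'I_K} :=
  [set k | grp k == i]%SET.

(* This is a probability as soon as g s <= #|group grp s|, which holds for all
   sufficiently large systems. *)
Definition tx_prob (R : realType) (K r : nat) (g : 'I_r -> R)
    (grp : 'I_K -> 'I_r) (k : 'I_K) (s : 'I_r) : R :=
  if grp k == s then g s / #|group grp s|%:R else 0.

(* Independent Bernoulli transmissions. *)
Definition frame_prob (R : realType) (K r : nat) (N : 'I_r -> nat)
    (g : 'I_r -> R) (grp : 'I_K -> 'I_r) (x : frame K N) : R :=
  \prod_(e : 'I_K * slot N)
    (if x e then tx_prob g grp e.1 (tag e.2)
     else 1 - tx_prob g grp e.1 (tag e.2)).

Definition expect (R : realType) (K r : nat) (N : 'I_r -> nat)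
    (g : 'I_r -> R) (grp : 'I_K -> 'I_r) (X : frame K N -> R) : R :=
  \sum_(x : frame K N) frame_prob g grp x * X x.

(* One SIC iteration on the received slots V, where D is the set of devices
   resolved so far: a device is resolved when it is the only device outside D
   that transmitted in some slot of V. *)
Definition sic_step (K r : nat) (N : 'I_r -> nat) (x : frame K N)
    (V : {set slot N}) (D : {set 'I_K}) : {set 'I_K} :=
  (D :|: [set k | [exists t in V,
                     [set k' in ~: D | x (k', t)] == [set k]]])%SET.

(* Devices resolved after the first n subframes, when l SIC iterations are run
   at the end of each subframe on all the slots received up to then. *)
Fixpoint resolved (K r : nat) (N : 'I_r -> nat) (x : frame K N) (l n : nat) :
    {set 'I_K} :=
  if n is n'.+1 then
    iter l (sic_step x [set t : slot N | ((tag t : 'I_r) <= n')%N]%SET) (resolved x l n')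
  else finset.set0.

(* Devices of group i unresolved at the end of subframe i; as subframes are
   numbered from 0, this is after i.+1 subframes. *)
Definition unresolved (K r : nat) (N : 'I_r -> nat) (grp : 'I_K -> 'I_r)
    (x : frame K N) (l : nat) (i : 'I_r) : {set 'I_K} :=
  (group grp i :\: resolved x l i.+1)%SET.

Definition unresolved_fraction (R : realType) (K r : nat) (N : 'I_r -> nat)
    (g : 'I_r -> R) (grp : 'I_K -> 'I_r) (l : nat) (i : 'I_r) : R :=
  expect g grp (fun x : frame K N =>
    #|unresolved grp x l i|%:R / #|group grp i|%:R).

Definition unresolved_prob (R : realType) (K r : nat) (N : 'I_r -> nat)
    (g : 'I_r -> R) (grp : 'I_K -> 'I_r) (l : nat) (k : 'I_K) : R :=
  expect g grp (fun x : frame K N => (k \in unresolved grp x l (grp k))%:R).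

(* Limiting unresolved fraction with l SIC iterations, for the sequence of
   systems indexed by the number K of devices. *)
Definition epsilon_iter (R : realType) (r : nat) (N : nat -> 'I_r -> nat)
    (g : 'I_r -> R) (grp : forall K : nat, 'I_K -> 'I_r) (i : 'I_r) (l : nat) :
    R :=
  limn (fun K => unresolved_fraction (N K) g (grp K) l i).

Definition epsilon (R : realType) (r : nat) (N : nat -> 'I_r -> nat)
    (g : 'I_r -> R) (grp : forall K : nat, 'I_K -> 'I_r) (i : 'I_r) : R :=
  limn (epsilon_iter N g grp i).

(* The term d = 0 vanishes because of the factor d. *)
Definition edge_gf (R : realType) (P : nat -> R) (x : R) : R :=
  limn (series (fun d => d%:R * P d * x ^+ d.-1)) /
  limn (series (fun d => d%:R * P d)).

Definition Lambda (R : realType) (r : nat) (alpha nu g : 'I_r -> R) (i : 'I_r) :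
    nat -> R :=
  poisson_pmf (g i * nu i / alpha i).

Definition Omega (R : realType) (r : nat) (g : 'I_r -> R) (i : 'I_r) :
    nat -> R :=
  poisson_pmf (g i).

Fixpoint q (R : realType) (r : nat) (alpha nu g : 'I_r -> R) (i : 'I_r)
    (l : nat) : R :=
  if l is l'.+1 then
    edge_gf (Lambda alpha nu g i)
      (1 - edge_gf (Omega g i) (1 - q alpha nu g i l'))
  else 1.

(* Main.v *)
(* The argument rests on an exact cavity identity. For a set A of devices
   of one group, all of A is unresolved after l.+1 iterations iff every
   slot hit by exactly one member of A also contains a device still
   unresolved after l iterations of peeling on the system from which A and
   all the slots hit by A have been deleted. The edges at A, the edges of
   the smaller system and the edges joining the two are independent, so
   that P(A unresolved after l.+1) = E[(1 - (1 - p)^U)^S], with S the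
   number of slots hit exactly once by A and U the number of unresolved
   devices in the smaller system after l iterations. By induction on l
   this tends to q_l^|A|, uniformly over all systems close to the limit:
   the cases |A| = 1, 2 give the first two moments of U, hence its
   concentration, and S is asymptotically Poisson. Since the Poisson
   generating functions give q_{l+1} = exp (- zeta exp (- g q_l)), a
   decreasing sequence, l can then go to infinity. *)
Require Import Defs.
From HB Require Import structures.
From mathcomp Require Import all_boot all_order all_algebra.
From mathcomp Require Import all_classical all_reals all_analysis.
From mathcomp Require Import ring lra.

Set Implicit Arguments.
Unset Strict Implicit.
Unset Printing Implicit Defensive.

Import Order.TTheory GRing.Theory Num.Theory.
Import numFieldNormedType.Exports.

Local Open Scope ring_scope.

(** * Expectation under a finite family of independent Bernoulli variables *)

Section Bernoulli.
Variables (R : realFieldType) (I : finType) (w : I -> R).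
Implicit Types (x y : {ffun I -> bool}) (f h : {ffun I -> bool} -> R).

Definition bern x : R := \prod_e (if x e then w e else 1 - w e).

Definition bernE f : R := \sum_x bern x * f x.

(** Distributing the product of two-term sums over the coordinates yields one term per
    configuration. *)
Lemma bernE_prod (h : I -> bool -> R) :
  bernE (fun x => \prod_e h e (x e)) =
  \prod_e (w e * h e true + (1 - w e) * h e false).
Proof.
under [RHS]eq_bigr => e _.
  rewrite -(big_bool _ (fun b : bool => (if b then w e else 1 - w e) * h e b)).
  over.
rewrite bigA_distr_bigA /bernE /=.
by apply: eq_bigr => x _; rewrite /bern -big_split.
Qed.

Lemma bernE_eq f h : f =1 h -> bernE f = bernE h.
Proof. by move=> fh; apply: eq_bigr => x _; rewrite fh. Qed.

Lemma bernED f h : bernE (fun x => f x + h x) = bernE f + bernE h.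
Proof. by rewrite /bernE -big_split; apply: eq_bigr => x _; rewrite mulrDr. Qed.

Lemma bernEZ (a : R) f : bernE (fun x => a * f x) = a * bernE f.
Proof.
by rewrite /bernE mulr_sumr; apply: eq_bigr => x _; rewrite mulrCA.
Qed.

Lemma bernEN f : bernE (fun x => - f x) = - bernE f.
Proof.
by rewrite -mulN1r -bernEZ; apply: bernE_eq => x; rewrite mulN1r.
Qed.

Lemma bernEB f h : bernE (fun x => f x - h x) = bernE f - bernE h.
Proof. by rewrite bernED bernEN. Qed.

Lemma bernE_sum (J : Type) (r : seq J) (P : pred J)
    (F : J -> {ffun I -> bool} -> R) :
  bernE (fun x => \sum_(j <- r | P j) F j x) =
  \sum_(j <- r | P j) bernE (F j).
Proof.
rewrite /bernE exchange_big /=; apply: eq_bigr => x _.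
by rewrite mulr_sumr.
Qed.

Lemma bernE_cst (a : R) : bernE (fun=> a) = a.
Proof.
rewrite -[a in LHS]mulr1 bernEZ -[X in _ * X]/(bernE (fun=> 1)).
have -> : bernE (fun=> 1) = bernE (fun x => \prod_e (fun _ _ => 1) e (x e)).
  by apply: bernE_eq => x; rewrite big1.
rewrite (bernE_prod (fun _ _ => 1)) big1 ?mulr1// => e _.
by rewrite !mulr1 addrC subrK.
Qed.

Definition glue (B : pred I) x y : {ffun I -> bool} :=
  [ffun e => if B e then x e else y e].

(** Resampling: for two independent copies, exchanging their coordinates outside [B] is an
    involution that preserves the product weight, so the glued configuration has the law of a single
    copy. *)
Lemma bernE_glue (B : pred I) f :
  bernE f = bernE (fun x => bernE (fun y => f (glue B x y))).
Proof.
pose swap u := (glue B u.1 u.2, glue B u.2 u.1).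
have swapK : involutive swap.
  by case=> x y; congr pair; apply/ffunP => e; rewrite !ffunE; case: (B e).
have -> : bernE f = bernE (fun x => bernE (fun y => f x)).
  by apply: bernE_eq => x; rewrite bernE_cst.
rewrite /bernE.
under eq_bigr do rewrite mulr_sumr.
under [RHS]eq_bigr do rewrite mulr_sumr.
rewrite !pair_big (reindex_inj (inv_inj swapK)) /=.
apply: eq_bigr => -[x y] _ /=; rewrite !mulrA; congr (_ * _).
rewrite -!big_split; apply: eq_bigr => e _ /=; rewrite !ffunE.
by case: (B e) => //; rewrite mulrC.
Qed.

(** Plays the role of measurability with respect to the coordinates in [B]. *)
Definition depends_on (T : Type) (B : pred I) (f : {ffun I -> bool} -> T) :=
  forall x y, (forall e, B e -> x e = y e) -> f x = f y.

(** After gluing, [f] sees only the first copy and [h] only the second, so the double expectation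
    factors. *)
Lemma bernE_indep (B : pred I) f h :
  depends_on B f -> depends_on (predC B) h ->
  bernE (fun x => f x * h x) = bernE f * bernE h.
Proof.
move=> fB hB; rewrite (bernE_glue B) mulrC -bernEZ.
apply: bernE_eq => x; rewrite mulrC -bernEZ; apply: bernE_eq => y.
congr (_ * _).
  by apply: fB => e Be; rewrite ffunE Be.
by apply: hB => e /= /negbTE nBe; rewrite ffunE nBe.
Qed.

(** The fibres of [c] are disjoint blocks of coordinates; independence splits them off one at a
    time. Later [c] is [fst] (blocks by device) or [snd] (blocks by slot). *)
Lemma bernE_blocks (J : finType) (c : I -> J) (S : {set J})
    (F : J -> {ffun I -> bool} -> R) :
  (forall j, j \in S -> depends_on (fun e => c e == j) (F j)) ->
  bernE (fun x => \prod_(j in S) F j x) = \prod_(j in S) bernE (F j).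
Proof.
move=> depF.
rewrite -[RHS]big_enum /= (bernE_eq (fun x => esym (big_enum _ _ _ _))) /=.
have : {in enum S, forall j, j \in S} by move=> j; rewrite mem_enum.
elim: (enum S) (enum_uniq S) => [_ _|j s IHs /= /andP[js us] sS].
  by rewrite big_nil -[RHS]bernE_cst; apply: bernE_eq => x; rewrite big_nil.
rewrite big_cons -IHs//; last by move=> k ks; apply: sS; rewrite inE ks orbT.
rewrite -(@bernE_indep (fun e => c e == j)).
- by apply: bernE_eq => x; rewrite big_cons.
- by apply/depF/sS/mem_head.
move=> x y xy; rewrite !big_seq; apply: eq_bigr => k ks.
apply: depF => [|e /eqP ek]; first by apply: sS; rewrite inE ks orbT.
by apply: xy => /=; rewrite ek; apply: contraNneq js => <-.
Qed.

Lemma bernE_coord e0 (h : bool -> R) :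
  bernE (fun x => h (x e0)) = w e0 * h true + (1 - w e0) * h false.
Proof.
have -> : bernE (fun x => h (x e0)) =
    bernE (fun x => \prod_e (if e == e0 then h (x e) else 1)).
  by apply: bernE_eq => x; rewrite -big_mkcond big_pred1_eq.
rewrite (bernE_prod (fun e b => if e == e0 then h b else 1)).
rewrite (bigD1 e0)//= eqxx big1 ?mulr1// => e /negbTE ->.
by rewrite !mulr1 addrC subrK.
Qed.

Hypothesis w01 : forall e, 0 <= w e <= 1.

Lemma bern_ge0 x : 0 <= bern x.
Proof.
apply: prodr_ge0 => e _; have /andP[w0 w1] := w01 e.
by case: ifP => //; rewrite subr_ge0.
Qed.

Lemma ler_bernE f h : (forall x, f x <= h x) -> bernE f <= bernE h.
Proof. by move=> fh; apply: ler_sum => x _; rewrite ler_wpM2l ?bern_ge0. Qed.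

Lemma ler_norm_bernE f : `|bernE f| <= bernE (fun x => `|f x|).
Proof.
apply: le_trans (ler_norm_sum _ _ _) _; apply: ler_sum => x _.
by rewrite normrM (ger0_norm (bern_ge0 x)).
Qed.

End Bernoulli.

(** * Deterministic peeling and the cavity identity *)

Section Peeling.
Variables (Dev Slot : finType).
Implicit Types (x y : {ffun Dev * Slot -> bool}) (A G : {set Dev})
  (V : {set Slot}) (k : Dev) (t : Slot) (l : nat).

(** Peeling is tracked through the unresolved set and parametrised by [G] and [V], so that deleting
    devices or slots only changes these two sets. *)
Fixpoint unr l G V x : {set Dev} :=
  if l is l'.+1 then
    [set k in unr l' G V x |
      [forall t in V, x (k, t) ==>
        [exists k' in unr l' G V x, (k' != k) && x (k', t)]]]%SET
  else G.

Definition untouched A V x : {set Slot} :=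
  [set t in V | [forall k in A, ~~ x (k, t)]]%SET.

Definition singly A x t : bool :=
  [exists k in A, x (k, t) && [forall k' in A, (k' != k) ==> ~~ x (k', t)]].

Lemma unrSP l G V x k :
  reflect (k \in unr l G V x /\ forall t, t \in V -> x (k, t) ->
             exists k', [/\ k' \in unr l G V x, k' != k & x (k', t)])
          (k \in unr l.+1 G V x).
Proof.
rewrite /= inE; apply: (iffP andP) => -[ku].
  move=> /forall_inP H; split=> // t tV xkt.
  have /exists_inP[k' k'u /andP[k'k xk't]] := implyP (H t tV) xkt.
  by exists k'.
move=> H; split=> //; apply/forall_inP => t tV; apply/implyP => xkt.
have [k' [k'u k'k xk't]] := H t tV xkt.
by apply/exists_inP; exists k' => //; rewrite k'k.
Qed.

Lemma unr_subS l G V x : unr l.+1 G V x \subset unr l G V x.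
Proof. by apply/fintype.subsetP => k /unrSP[]. Qed.

Lemma unr_anti l m G V x : (l <= m)%N -> unr m G V x \subset unr l G V x.
Proof.
move=> /subnK <-; elim: (m - l)%N => [|n IHn]; first by rewrite add0n.
exact: fintype.subset_trans (unr_subS _ _ _ _) IHn.
Qed.

Lemma unr_sub l G V x : unr l G V x \subset G.
Proof. exact: (@unr_anti 0). Qed.

Lemma untouchedP A V x t :
  reflect (t \in V /\ forall k, k \in A -> ~~ x (k, t)) (t \in untouched A V x).
Proof. by rewrite inE; apply: (iffP andP) => -[tV] /forall_inP. Qed.

Lemma touchedP A V x t : t \in V -> t \notin untouched A V x ->
  exists2 k, k \in A & x (k, t).
Proof.
move=> tV; rewrite inE tV /= negb_forall_in => /exists_inP[k kA].
by rewrite negbK; exists k.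
Qed.

(** Induction on [l]: every touched slot contains a member of [A], still unresolved, which blocks
    the resolution of any device outside [A] there. *)
Lemma unr_cavity l A G V x : A \subset G -> A \subset unr l G V x ->
  unr l G V x = (A :|: unr l (G :\: A) (untouched A V x) x)%SET.
Proof.
move=> AG; elim: l => [|l IHl] Aunr.
  by rewrite /= -{1}(finset.setIidPr AG) finset.setID.
have {}IHl := IHl (fintype.subset_trans Aunr (unr_subS _ _ _ _)).
apply/setP => k; rewrite finset.in_setU; have [kA|kA] /= := boolP (k \in A).
  exact: fintype.subsetP Aunr _ kA.
apply/unrSP/unrSP; rewrite !IHl finset.in_setU (negbTE kA) /= => -[ku H];
  split=> // t.
  move=> /untouchedP[tV tA] /(H t tV)[k' [+ k'k xk't]].
  rewrite finset.in_setU => /orP[/tA|k'u]; first by rewrite xk't.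
  by exists k'.
move=> tV xkt; have [tu|tu] := boolP (t \in untouched A V x).
  have [k' [k'u k'k xk't]] := H t tu xkt.
  by exists k'; split=> //; rewrite finset.in_setU k'u orbT.
have [a aA xat] := touchedP tV tu.
exists a; split=> //; first by rewrite finset.in_setU aA.
by apply: contraNneq kA => <-.
Qed.

(* Freezing A: as long as all of A is unresolved, the slots touched by A resolve
   nobody outside A, so the other devices peel as if A and those slots were
   absent. *)
Lemma subset_unrS l A G V x : A \subset G ->
  (A \subset unr l.+1 G V x) =
  [forall t in V, singly A x t ==>
    [exists k in unr l (G :\: A)%SET (untouched A V x) x, x (k, t)]].
Proof.
move=> AG; apply/idP/forall_inP => [Aunr t tV|H].
  apply/implyP => /exists_inP[a aA /andP[xat /forall_inP at1]].
  have /unrSP[_ /(_ t tV xat)[k [+ ka xkt]]] := fintype.subsetP Aunr _ aA.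
  rewrite (unr_cavity AG (fintype.subset_trans Aunr (unr_subS _ _ _ _))).
  rewrite finset.in_setU => /orP[kA|ku].
    by have /implyP/(_ ka) := at1 k kA; rewrite xkt.
  by apply/exists_inP; exists k.
(* While [A] survives up to round [j], the cavity identity describes that round. Blockers present
   after [l] rounds are also present earlier, because unresolved sets decrease. *)
suff HA j : (j <= l.+1)%N -> A \subset unr j G V x by exact: HA.
elim: j => [_|j IHj jl]; first exact: AG.
have Aunr := IHj (ltnW jl).
apply/fintype.subsetP => a aA; apply/unrSP; split=> [|t tV xat].
  exact: fintype.subsetP Aunr _ aA.
rewrite (unr_cavity AG Aunr).
(* In a slot hit once by [A] the blocker comes from the smaller system; otherwise a second member of
   [A] blocks. *)
have [/(implyP (H t tV))/exists_inP[k ku xkt]|] := boolP (singly A x t).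
  exists k; split=> //.
    have := fintype.subsetP (unr_anti _ _ _ (jl : (j <= l)%N)) _ ku.
    by rewrite finset.in_setU => ->; rewrite orbT.
  apply: contraTneq ku => ->; apply/negP => /(fintype.subsetP (unr_sub _ _ _ _)).
  by rewrite finset.in_setD aA.
rewrite negb_exists_in => /forall_inP/(_ a aA); rewrite xat /= negb_forall_in.
move=> /exists_inP[k kA]; rewrite negb_imply negbK => /andP[ka xkt].
by exists k; rewrite finset.in_setU kA.
Qed.

(** Locality: this is what allows edges outside [G] and [V] to be replaced by those of an
    independent copy. *)
Lemma eq_unr l G V x y :
  (forall k t, k \in G -> t \in V -> x (k, t) = y (k, t)) ->
  unr l G V x = unr l G V y.
Proof.
move=> xy; elim: l => //= l ->; apply/setP => k; rewrite !inE.
have [ku /=|//] := boolP (k \in unr l G V y).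
have kG := fintype.subsetP (unr_sub _ _ _ _) _ ku.
apply: eq_forallb_in => t tV; rewrite xy//; congr (_ ==> _).
apply: eq_existsb_in => k' /(fintype.subsetP (unr_sub _ _ _ _)) k'G.
by rewrite xy.
Qed.

End Peeling.

(** * Elementary estimates for powers and exponentials *)

Lemma distX_le (R : realFieldType) (x y : R) n :
  0 <= x <= 1 -> 0 <= y <= 1 -> `|x ^+ n - y ^+ n| <= n%:R * `|x - y|.
Proof.
move=> /andP[x0 x1] /andP[y0 y1]; elim: n => [|n IHn].
  by rewrite !expr0 subrr normr0 mul0r.
have -> : x ^+ n.+1 - y ^+ n.+1 = x * (x ^+ n - y ^+ n) + (x - y) * y ^+ n.
  by rewrite !exprS; ring.
apply: le_trans (ler_normD _ _) _; rewrite !normrM -natr1 mulrDl mul1r lerD//.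
  by apply: le_trans IHn; rewrite ler_piMl// ger0_norm.
by rewrite ler_piMr// ger0_norm ?exprn_ge0// exprn_ile1.
Qed.

Lemma dist_expRN_le (R : realType) (a b : R) :
  0 <= a -> 0 <= b -> `|expR (- a) - expR (- b)| <= `|a - b|.
Proof.
wlog ab : a b / a <= b => [H a0 b0|a0 _].
  have [/H|/ltW/H] := leP a b; first exact.
  by rewrite distrC (distrC a); apply.
have := expR_ge1Dx (a - b).
have -> : expR (- b) = expR (- a) * expR (a - b).
  by rewrite -expRD; congr expR; ring.
have := expR_gt0 (- a).
have : expR (- a) <= 1 by rewrite -expR0 ler_expR oppr_le0.
have : expR (a - b) <= 1 by rewrite -expR0 ler_expR subr_le0.
set u := expR (- a); set v := expR (a - b) => v1 u1 u0 abv.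
rewrite ger0_norm; last by nra.
rewrite ler0_norm; last by lra.
nra.
Qed.

(** Quantitative Poisson approximation, through the intermediate value [expR (- (n%:R * y))]: the
    bases [1 - y] and [expR (- y)] differ by at most [y * y], and the exponents are compared by the
    Lipschitz bound. *)
Lemma dist_pow1B_expR (R : realType) (y s : R) n : 0 <= y <= 1 -> 0 <= s ->
  `|(1 - y) ^+ n - expR (- s)| <= n%:R * y * y + `|n%:R * y - s|.
Proof.
move=> /andP[y0 y1] s0.
rewrite -(subrKA (expR (- (n%:R * y)))).
apply: le_trans (ler_normD _ _) _; rewrite lerD ?dist_expRN_le ?mulr_ge0//.
rewrite -mulrN expRM_natl -mulrA.
have e1 : expR (- y) <= 1 by rewrite -expR0 ler_expR oppr_le0.
have eV : expR y * expR (- y) = 1 by rewrite -expRD subrr expR0.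
have e0 := expR_gt0 (- y).
have := expR_ge1Dx y; have := expR_ge1Dx (- y).
move: (expR y) (expR (- y)) e1 eV e0 => u v v1 uv v0 v1y u1y.
apply: le_trans (distX_le _ _ _) _; [by lra|by lra|].
rewrite ler_wpM2l// distrC ger0_norm; last by lra.
(* With [v >= 1 - y] this gives [v <= 1 - y * v <= 1 - y + y * y]. *)
have : (1 + y) * v <= 1 by nra.
nra.
Qed.

(** * The cavity recursion in expectation *)

Lemma natr_forall (R : pzSemiRingType) (T : finType) (S P : pred T) :
  [forall (t | S t), P t]%:R = \prod_(t | S t) (P t)%:R :> R.
Proof.
rewrite -big_andE.
by apply: (big_morph (fun b : bool => b%:R : R)) => // a b; rewrite -natrM mulnb.
Qed.

Section Expectation.
Variables (R : realType) (Dev Slot : finType) (w : Dev * Slot -> R).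
Variables (p : R) (G : {set Dev}) (V : {set Slot}).
Hypothesis w01 : forall e, 0 <= w e <= 1.
Hypothesis wp : forall k t, k \in G -> t \in V -> w (k, t) = p.
Implicit Types (A : {set Dev}) (x y : {ffun Dev * Slot -> bool}).

Definition Punr l A : R := bernE w (fun x => (A \subset unr l G V x)%:R).

Definition nsingly A x : nat := #|[set t in V | singly A x t]%SET|.

Lemma singly_dep A t : depends_on (fun e => e.2 == t) (fun x => singly A x t).
Proof.
move=> x y xy; apply: eq_existsb_in => k kA; rewrite xy//=; congr (_ && _).
by apply: eq_forallb_in => k' k'A; rewrite xy//=.
Qed.

Lemma bernE_hit (U : {set Dev}) t : U \subset G -> t \in V ->
  bernE w (fun x => [exists k in U, x (k, t)]%:R) = 1 - (1 - p) ^+ #|U|.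
Proof.
move=> UG tV.
have -> : bernE w (fun x => [exists k in U, x (k, t)]%:R) =
    bernE w (fun x => 1 - \prod_(k in U) (~~ x (k, t))%:R).
  apply: bernE_eq => x; rewrite -natr_forall -[in LHS](negbK [exists _ in _, _]).
  by rewrite negb_exists_in; case: [forall _ in _, _]; rewrite (subr0, subrr).
rewrite bernEB bernE_cst (bernE_blocks w (c := fst)); last first.
  by move=> k _ x y xy; rewrite xy//=.
congr (_ - _); rewrite -prodr_const; apply: eq_bigr => k kU.
rewrite (bernE_coord w (k, t) (fun b => (~~ b)%:R)) mulr0 mulr1 add0r wp//.
exact: fintype.subsetP UG _ kU.
Qed.

(** By [subset_unrS], survival of [A] means that each slot hit once by [A] is also hit by the set
    unresolved in the smaller system. Given that set, of size [U], each such slot is hit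
    independently with probability [1 - (1 - p) ^+ U]. *)
Lemma Punr_rec l A : A \subset G ->
  Punr l.+1 A = bernE w (fun x => bernE w (fun y =>
    (1 - (1 - p) ^+ #|unr l (G :\: A)%SET (untouched A V x) y|)
      ^+ nsingly A x)).
Proof.
(* The edges at [A] are read from [x], all others from an independent copy. *)
move=> AG; rewrite /Punr (bernE_glue w (fun e => e.1 \in A)).
apply: bernE_eq => x; set V0 := untouched A V x.
pose V1 := [set t in V | singly A x t]%SET.
have V01 t : t \in V1 -> t \in V0 = false.
  rewrite inE => /andP[_ /exists_inP[k kA /andP[xkt _]]].
  by apply/negP => /untouchedP[_ /(_ k kA)]; rewrite xkt.
rewrite (_ : bernE w _ = bernE w (fun y => \prod_(t in V1)
    [exists k in unr l (G :\: A)%SET V0 y, y (k, t)]%:R)); last first.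
  apply: bernE_eq => y; rewrite subset_unrS//.
  set z := glue _ x y.
  have xz k t : k \in A -> z (k, t) = x (k, t) by move=> kA; rewrite ffunE kA.
  have yz k t : k \in (G :\: A)%SET -> z (k, t) = y (k, t).
    by rewrite finset.in_setD ffunE /= => /andP[/negbTE ->].
  have -> : untouched A V z = V0.
    apply/setP => t; rewrite !inE; congr (_ && _).
    by apply: eq_forallb_in => k kA; rewrite xz.
  rewrite (eq_unr _ (y := y)); last by move=> k t kGA _; rewrite yz.
  rewrite -natr_forall; congr (nat_of_bool _)%:R; apply: eq_forallb => t.
  rewrite inE; case: (t \in V) => //=.
  rewrite (_ : singly A z t = singly A x t); last first.
    apply: eq_existsb_in => k kA; rewrite xz//; congr (_ && _).
    by apply: eq_forallb_in => k' k'A; rewrite xz.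
  congr (_ ==> _).
  by apply: eq_existsb_in => k /(fintype.subsetP (unr_sub _ _ _ _))/yz ->.
(* The other edges are split again: those in untouched slots fix the unresolved set, while those in
   the slots of [V1], disjoint from [V0], are resampled as [z]. *)
rewrite (bernE_glue w (fun e => e.2 \in V0)); apply: bernE_eq => y.
set U := unr _ _ _ y.
rewrite (_ : bernE w _ = bernE w (fun z =>
    \prod_(t in V1) [exists k in U, z (k, t)]%:R)); last first.
  apply: bernE_eq => z; apply: eq_bigr => t tV1.
  rewrite (eq_unr _ (y := y)) => [|k s _ sV0]; last by rewrite ffunE /= sV0.
  congr (nat_of_bool _)%:R; apply: eq_existsb_in => k _.
  by rewrite ffunE /= V01.
rewrite (bernE_blocks w (c := snd)) => [|t _ z z' zz']; last first.
  by congr (nat_of_bool _)%:R; apply: eq_existsb_in => k _; rewrite zz'/=.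
rewrite /nsingly -prodr_const; apply: eq_bigr => t; rewrite inE => /andP[tV _].
rewrite bernE_hit//; apply: fintype.subset_trans (unr_sub _ _ _ _) _.
exact: subsetDl.
Qed.

(** The event is the disjoint union, over [k] in [A], of the events that [k] alone transmits; each
    indicator is a product over devices. *)
Lemma bernE_singly A t : A \subset G -> t \in V ->
  bernE w (fun x => (singly A x t)%:R) = #|A|%:R * p * (1 - p) ^+ #|A|.-1.
Proof.
move=> AG tV.
rewrite (_ : bernE w _ = bernE w (fun x => \sum_(k in A) \prod_(k' in A)
   (if k' == k then x (k', t) else ~~ x (k', t))%:R)); last first.
  apply: bernE_eq => x; under eq_bigr do rewrite -natr_forall.
  have [/exists_inP[k kA /andP[xkt /forall_inP xk't]]|] := boolP (singly A x t).
    rewrite (bigD1 k)//= big1 ?addr0 => [|j /andP[jA jk]].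
      suff -> : [forall k' in A, if k' == k then x (k', t) else ~~ x (k', t)].
        by [].
      apply/forall_inP => k' k'A; have [->//|k'k] := eqVneq k' k.
      by have /implyP := xk't _ k'A; apply.
    apply/eqP; rewrite pnatr_eq0 eqb0; apply/negP => /forall_inP/(_ k kA).
    by rewrite eq_sym (negbTE jk) xkt.
  rewrite negb_exists_in => /forall_inP H; rewrite big1// => k kA.
  apply/eqP; rewrite pnatr_eq0 eqb0; apply/negP => /forall_inP Hk.
  have := H k kA; have := Hk k kA; rewrite eqxx => -> /=.
  move=> /negP[]; apply/forall_inP => k' k'A; apply/implyP => k'k.
  by have := Hk k' k'A; rewrite (negbTE k'k).
rewrite bernE_sum -mulrA mulr_natl -sumr_const; apply: eq_bigr => k kA.
rewrite (bernE_blocks w (c := fst)) => [|k' _ x y xy]; last by rewrite xy.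
rewrite (bigD1 k)//= eqxx (bernE_coord w (k, t) (fun b => b%:R)).
rewrite mulr1 mulr0 addr0 wp ?(fintype.subsetP AG)//; congr (_ * _).
rewrite (cardsD1 k) kA /= -prodr_const; apply: eq_big => [k'|k'].
  by rewrite !inE andbC.
move=> /andP[k'A /negbTE ->].
rewrite (bernE_coord w (k', t) (fun b => (~~ b)%:R)).
by rewrite mulr1 mulr0 add0r wp ?(fintype.subsetP AG).
Qed.

(** The count of singly hit slots is binomial: [c ^+ nsingly A x] factors into independent
    contributions [1 - (1 - c) * singly], one per slot. *)
Lemma bernE_exp_nsingly A (c : R) : A \subset G ->
  bernE w (fun x => c ^+ nsingly A x) =
  (1 - (1 - c) * (#|A|%:R * p * (1 - p) ^+ #|A|.-1)) ^+ #|V|.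
Proof.
move=> AG.
rewrite (_ : bernE w _ = bernE w (fun x =>
    \prod_(t in V) (1 - (1 - c) * (singly A x t)%:R))); last first.
  apply: bernE_eq => x; rewrite /nsingly -prodr_const big_mkcond [RHS]big_mkcond.
  apply: eq_bigr => t _; rewrite inE; case: (t \in V) => //=.
  by case: (singly A x t); rewrite (mulr1, mulr0) ?subr0// opprB addrC subrK.
rewrite (bernE_blocks w (c := snd)) => [|t _ x y xy]; last first.
  by rewrite (singly_dep _ xy).
rewrite -prodr_const; apply: eq_bigr => t tV.
by rewrite bernEB bernE_cst bernEZ bernE_singly.
Qed.

(** First-moment bound: there are at most as many touched slots as edges at [A]. *)
Lemma bernE_touched A : A \subset G ->
  bernE w (fun x => #|V :\: untouched A V x|%:R) <= #|A|%:R * (p * #|V|%:R).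
Proof.
move=> AG.
have -> : #|A|%:R * (p * #|V|%:R) =
    bernE w (fun x => \sum_(t in V) \sum_(k in A) (x (k, t))%:R).
  rewrite bernE_sum mulrA mulr_natl mulr_natr.
  rewrite -sumr_const; apply: eq_bigr => t tV.
  rewrite bernE_sum -sumr_const; apply: eq_bigr => k kA.
  rewrite (bernE_coord w (k, t) (fun b => b%:R)) mulr1 mulr0 addr0 wp//.
  exact: fintype.subsetP AG _ kA.
apply: ler_bernE => // x.
rewrite -sum1_card natr_sum big_mkcond [leRHS]big_mkcond; apply: ler_sum => t _.
rewrite finset.in_setD andbC; case: ifPn => [/andP[tV tu]|_]; last first.
  by case: ifP => // _; apply: sumr_ge0.
rewrite tV; have [k kA xkt] := touchedP tV tu.
by rewrite (bigD1 k)//= xkt lerDl sumr_ge0.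
Qed.

End Expectation.

(** * Convergence of survival probabilities, uniformly over systems near the limit *)

Section Limit.
Variables (R : realType) (g zeta : R).
Hypotheses (g_ge0 : 0 <= g) (zeta_ge0 : 0 <= zeta).

(* A system of devices G and slots V, embedded in a larger one, that is
   delta-close to the limit p -> 0, p |G| -> g, p |V| -> zeta. *)
Definition regime (delta : R) (Dev Slot : finType) (w : Dev * Slot -> R) (p : R)
    (G : {set Dev}) (V : {set Slot}) : Prop :=
  [/\ forall e, 0 <= w e <= 1,
      forall k t, k \in G -> t \in V -> w (k, t) = p,
      0 <= p <= delta,
      `|p * #|G|%:R - g| <= delta &
      `|p * #|V|%:R - zeta| <= delta].

Lemma regimeW delta delta' Dev Slot w p (G : {set Dev}) (V : {set Slot}) :
  delta <= delta' -> regime delta w p G V -> regime delta' w p G V.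
Proof.
move=> dd' [w01 wp /andP[p0 pd] pG pV]; split=> //.
- by rewrite p0 (le_trans pd).
- exact: le_trans dd'.
- exact: le_trans dd'.
Qed.

(** The bound [delta] is chosen before the system because the recursion passes to a random smaller
    system. All sizes [m] are kept because the step needs the first and second moments, that is
    [m = 1] and [m = 2]. *)
Definition unr_cvg l (c : R) : Prop := forall (m : nat) (eps : R), 0 < eps ->
  exists2 delta : R, 0 < delta &
    forall (Dev Slot : finType) (w : Dev * Slot -> R) p (G : {set Dev})
      (V : {set Slot}) (A : {set Dev}),
    regime delta w p G V -> A \subset G -> #|A| = m ->
    `|Punr w G V l A - c ^+ m| <= eps.

Lemma card_unr (Dev Slot : finType) l (G : {set Dev}) (V : {set Slot}) x :
  #|unr l G V x|%:R = \sum_(k in G) ([set k]%SET \subset unr l G V x)%:R :> R.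
Proof.
rewrite -sum1_card natr_sum big_mkcond [RHS]big_mkcond; apply: eq_bigr => k _.
rewrite finset.sub1set; have [ku|] := boolP (k \in unr l G V x).
  by rewrite (fintype.subsetP (unr_sub _ _ _ _) _ ku).
by case: ifP.
Qed.

(** The square is expanded over pairs of devices. Distinct devices are nearly uncorrelated by the
    cases [m = 1, 2]; the diagonal is of order [p * (p * #|G|)], which vanishes with [p]. *)
Lemma unr_variance l c : 0 <= c <= 1 -> unr_cvg l c ->
  forall eps : R, 0 < eps -> exists2 delta : R, 0 < delta &
    forall (Dev Slot : finType) (w : Dev * Slot -> R) p (G : {set Dev})
      (V : {set Slot}), regime delta w p G V ->
    bernE w (fun x => (p * #|unr l G V x|%:R - p * #|G|%:R * c) ^+ 2) <= eps.
Proof.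
move=> c01 IH eps eps0; have /andP[c0 c1] := c01.
pose ga := g + 1.
have ga0 : 0 < ga by rewrite ltr_wpDl.
(* [ga] bounds [p * #|G|]. Off-diagonal pairs cost [3 * e1 * ga ^+ 2 = eps / 2] and the diagonal
   [ga * d3 = eps / 2]. *)
pose e1 := eps / (6 * ga ^+ 2).
have e10 : 0 < e1 by rewrite divr_gt0// mulr_gt0// exprn_gt0.
have [d1 d10 H1] := IH 1%N _ e10; have [d2 d20 H2] := IH 2%N _ e10.
pose d3 := eps / (2 * ga).
have d30 : 0 < d3 by rewrite divr_gt0// mulr_gt0.
exists (Num.min (Num.min d1 d2) (Num.min d3 1)).
  by rewrite !lt_min d10 d20 d30 ltr01.
move=> Dev Slot w p G V reg.
have [w01 wp /andP[p0 +] pG pV] := reg; rewrite !le_min => /and3P[_ pd3 p1].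
pose X k (x : {ffun Dev * Slot -> bool}) : R :=
  ([set k]%SET \subset unr l G V x)%:R.
have -> : bernE w (fun x => (p * #|unr l G V x|%:R - p * #|G|%:R * c) ^+ 2) =
  \sum_(k in G) \sum_(k' in G)
    p ^+ 2 * bernE w (fun x => (X k x - c) * (X k' x - c)).
  transitivity (bernE w (fun x => \sum_(k in G) \sum_(k' in G)
      (p ^+ 2 * ((X k x - c) * (X k' x - c))))).
    apply: bernE_eq => x.
    have -> : p * #|unr l G V x|%:R - p * #|G|%:R * c =
        p * \sum_(k in G) (X k x - c).
      by rewrite sumrB -card_unr sumr_const -mulr_natl; ring.
    rewrite exprMn [X in _ * X]expr2 mulr_suml mulr_sumr; apply: eq_bigr => k _.
    by rewrite !mulr_sumr.
  rewrite bernE_sum; apply: eq_bigr => k _.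
  by rewrite bernE_sum; apply: eq_bigr => k' _; rewrite bernEZ.
have pGle : p * #|G|%:R <= ga.
  have : `|p * #|G|%:R - g| <= 1.
    by apply: le_trans pG _; rewrite !ge_min lexx !orbT.
  by rewrite ler_norml /ga; lra.
have pG0 : 0 <= p * #|G|%:R by rewrite mulr_ge0.
have reg1 : regime d1 w p G V.
  by apply: regimeW reg; rewrite !ge_min lexx.
have reg2 : regime d2 w p G V.
  by apply: regimeW reg; rewrite !ge_min lexx orbT.
have offdiag k k' : k \in G -> k' \in G -> k != k' ->
    bernE w (fun x => (X k x - c) * (X k' x - c)) <= 3 * e1.
  move=> kG k'G kk'.
  have -> : bernE w (fun x => (X k x - c) * (X k' x - c)) =
      Punr w G V l [set k; k']%SET - c * Punr w G V l [set k]%SET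
        - c * Punr w G V l [set k']%SET + c ^+ 2.
    rewrite -[c ^+ 2](bernE_cst w) -!bernEZ -!bernEB -bernED.
    apply: bernE_eq => x.
    have -> : ([set k; k']%SET \subset unr l G V x)%:R = X k x * X k' x.
      by rewrite finset.subUset -mulnb natrM.
    rewrite /X; ring.
  have Hk := H1 _ _ _ _ _ _ [set k]%SET reg1.
  have {Hk} := Hk _ (cards1 _); rewrite finset.sub1set => /(_ kG).
  have Hk := H1 _ _ _ _ _ _ [set k']%SET reg1.
  have {Hk} := Hk _ (cards1 _); rewrite finset.sub1set => /(_ k'G).
  have Hk := H2 _ _ _ _ _ _ [set k; k']%SET reg2.
  have {Hk} := Hk _ _; rewrite cards2 kk' finset.subUset !finset.sub1set kG k'G.
  move=> /(_ isT erefl); rewrite !expr1.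
  move: (Punr _ _ _ _ _) (Punr _ _ _ _ _) (Punr _ _ _ _ _) => a b b'.
  rewrite !ler_norml => /andP[a1 a2] /andP[b1 b2] /andP[b3 b4].
  nra.
have diag k : bernE w (fun x => (X k x - c) * (X k x - c)) <= 1.
  rewrite -[leRHS](bernE_cst w); apply: ler_bernE => // x.
  by rewrite /X; case: (_ \subset _); rewrite /=; nra.
have -> : eps = ga * d3 + 3 * e1 * ga ^+ 2.
  by rewrite /d3 /e1; field; rewrite gt_eqF.
apply: (@le_trans _ _ (\sum_(k in G)
  (p ^+ 2 + \sum_(k' in G) p ^+ 2 * (3 * e1)))).
  apply: ler_sum => k kG; rewrite (bigD1 k)//= lerD//.
    by rewrite ler_piMr ?exprn_ge0.
  rewrite [leRHS](bigD1 k)//= -[leLHS]add0r lerD//.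
    by rewrite mulr_ge0 ?exprn_ge0// mulr_ge0// ltW.
  apply: ler_sum => k' /andP[k'G k'k].
  by rewrite ler_wpM2l ?exprn_ge0// offdiag// eq_sym.
rewrite big_split/= !sumr_const.
rewrite -[p ^+ 2 * _ *+ _]mulr_natr -[p ^+ 2 *+ _]mulr_natr.
rewrite -[_ * _ *+ #|G|]mulr_natr.
have -> : p ^+ 2 * #|G|%:R = (p * #|G|%:R) * p by ring.
have -> : p ^+ 2 * (3 * e1) * #|G|%:R * #|G|%:R =
  3 * e1 * (p * #|G|%:R) ^+ 2 by ring.
rewrite lerD//; first by rewrite ler_pM.
rewrite ler_wpM2l//; first by rewrite mulr_ge0// ltW.
by rewrite lerXn2r ?nnegrE// ltW.
Qed.

(** The power is close to [expR (- (p * U))] with [U] the number of unresolved devices, and [p * U]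
    is close to [g * c] by the variance bound. *)
Lemma unr_concentration l c : 0 <= c <= 1 -> unr_cvg l c ->
  forall eps : R, 0 < eps -> exists2 delta : R, 0 < delta &
    forall (Dev Slot : finType) (w : Dev * Slot -> R) p (G : {set Dev})
      (V : {set Slot}), regime delta w p G V ->
    bernE w (fun x => `|(1 - p) ^+ #|unr l G V x| - expR (- (g * c))|) <= eps.
Proof.
move=> c01 IH eps eps0; have /andP[c0 c1] := c01; have g0 := g_ge0.
(* A variance of [eps ^+ 2 / 4] contributes [eps / 4] after the factor [eps^-1] below. *)
have e10 : 0 < eps ^+ 2 / 4 by rewrite divr_gt0// exprn_gt0.
have [d1 d10 H1] := unr_variance c01 IH e10.
pose d2 := eps / (4 * (g + 2)).
have d20 : 0 < d2 by rewrite divr_gt0// mulr_gt0//; lra.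
exists (Num.min d1 (Num.min d2 1)); first by rewrite !lt_min d10 d20 ltr01.
move=> Dev Slot w p G V reg.
have [w01 wp /andP[p0 +] pG pV] := reg; rewrite !le_min => /and3P[_ pd2 p1].
move: pG; rewrite !le_min => /and3P[_ pG2 pG1].
have reg1 : regime d1 w p G V by apply: regimeW reg; rewrite ge_min lexx.
have pGle : p * #|G|%:R <= g + 1 by move: pG1; rewrite ler_norml; lra.
have pG0 : 0 <= p * #|G|%:R by rewrite mulr_ge0.
apply: (@le_trans _ _ (bernE w (fun x => (g + 2) * d2 + eps / 4 +
  (eps^-1 * (p * #|unr l G V x|%:R - p * #|G|%:R * c) ^+ 2)))).
  apply: ler_bernE => // x; set U := #|unr l G V x|%:R.
  have UG : U <= #|G|%:R by rewrite ler_nat subset_leq_card// unr_sub.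
  have U0 : 0 <= U by rewrite ler0n.
  apply: le_trans (dist_pow1B_expR _ _ _) _.
  - by rewrite p0 p1.
  - by rewrite mulr_ge0.
  rewrite -/U (mulrC U p).
  have pUp : p * U * p <= (g + 1) * d2.
    by rewrite ler_pM ?mulr_ge0//; apply: le_trans pGle; rewrite ler_wpM2l.
  set D := p * U - p * #|G|%:R * c.
  (* This pointwise inequality passes from second to first moment in place of Cauchy-Schwarz. *)
  have amgm : `|D| <= eps / 4 + eps^-1 * D ^+ 2.
    rewrite -(ler_pM2l eps0) mulrDr mulVKf ?gt_eqF//.
    rewrite -normr_id -[D ^+ 2]real_normK ?num_real//.
    move: `|D| (normr_ge0 D) => a a0; rewrite ger0_norm//.
    have := sqr_ge0 (a - eps / 2); rewrite !expr2; lra.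
  have : `|p * U - g * c| <= `|D| + d2.
    have -> : p * U - g * c = D + (p * #|G|%:R - g) * c by rewrite /D; ring.
    apply: le_trans (ler_normD _ _) _; rewrite lerD// normrM (ger0_norm c0).
    by apply: le_trans pG2; rewrite ler_piMr.
  lra.
rewrite bernED bernE_cst bernEZ.
apply: (@le_trans _ _ ((g + 2) * d2 + eps / 4 + eps^-1 * (eps ^+ 2 / 4))).
  by rewrite lerD// ler_wpM2l ?invr_ge0 ?(ltW eps0)// H1.
have -> : (g + 2) * d2 = eps / 4.
  by rewrite /d2; field; rewrite gt_eqF//; lra.
have -> : eps^-1 * (eps ^+ 2 / 4) = eps / 4 by field; rewrite gt_eqF.
lra.
Qed.


(** Deleting [A] and at most [D] slots shifts [p * #|G|] and [p * #|V|] by at most [p * #|A|] and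
    [p * D], with [p <= delta]. *)
Lemma regime_untouched delta delta' (Dev Slot : finType) (w : Dev * Slot -> R) p
    (G A : {set Dev}) (V : {set Slot}) x (D : R) :
  regime delta w p G V -> A \subset G ->
  #|V :\: untouched A V x|%:R <= D ->
  delta * (#|A|%:R + D + 1) <= delta' -> delta <= delta' ->
  regime delta' w p (G :\: A)%SET (untouched A V x).
Proof.
move=> [w01 wp /andP[p0 pd] pG pV] AG VD dd' dd.
have D0 : 0 <= D by apply: le_trans VD.
have A0 : 0 <= #|A|%:R :> R by rewrite ler0n.
have pA : p * #|A|%:R <= delta * #|A|%:R by rewrite ler_wpM2r.
have pA0 : 0 <= p * #|A|%:R by rewrite mulr_ge0.
have pD : p * D <= delta * D by rewrite ler_wpM2r.
have d0 : 0 <= delta by apply: le_trans pd.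
have dA0 : 0 <= delta * #|A|%:R by rewrite mulr_ge0.
have dD0 : 0 <= delta * D by rewrite mulr_ge0.
split=> //.
- move=> k t; rewrite finset.in_setD => /andP[_ kG] /untouchedP[tV _].
  exact: wp.
- by rewrite p0 (le_trans pd).
- have -> : #|(G :\: A)%SET|%:R = #|G|%:R - #|A|%:R :> R.
    by rewrite cardsDS// natrB// subset_leq_card.
  move: pG dd'; rewrite mulrBr !ler_norml; lra.
- have UV : untouched A V x \subset V.
    by apply/fintype.subsetP => t /untouchedP[].
  have -> : #|untouched A V x|%:R = #|V|%:R - #|V :\: untouched A V x|%:R :> R.
    by rewrite cardsDS// natrB ?subset_leq_card// opprB addrC subrK.
  have := ler_wpM2l p0 VD.
  have : 0 <= p * #|V :\: untouched A V x|%:R by rewrite mulr_ge0.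
  move: pV dd'; rewrite mulrBr !ler_norml; lra.
Qed.

Lemma nsingly_le (Dev Slot : finType) (A : {set Dev}) (V : {set Slot}) x :
  (nsingly V A x <= #|V :\: untouched A V x|)%N.
Proof.
apply/subset_leq_card/fintype.subsetP => t.
rewrite inE => /andP[tV /exists_inP[k kA /andP[xkt _]]].
rewrite finset.in_setD tV andbT; apply/negP => /untouchedP[_ /(_ k kA)].
by rewrite xkt.
Qed.

(** In [Punr_rec] the random base is first replaced by its limit [b = 1 - e], using concentration in
    the smaller system; the remaining expectation is explicit and converges to a Poisson generating
    function. *)
Lemma unr_cvgS l c : 0 <= c <= 1 -> unr_cvg l c ->
  unr_cvg l.+1 (expR (- (zeta * expR (- (g * c))))).
Proof.
move=> c01 IH m eps eps0; have z0 := zeta_ge0; have g0 := g_ge0.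
have /andP[c0 c1] := c01.
set e := expR (- (g * c)).
have e0 : 0 <= e by exact: expR_ge0.
have e1 : e <= 1 by rewrite -expR0 ler_expR oppr_le0 mulr_ge0.
pose M : R := m%:R; have M0 : 0 <= M by rewrite /M.
(* [D] is a cutoff for the number of touched slots; Markov's inequality bounds the probability of
   exceeding it by [eps / 4]. *)
have [D D1 HD] : exists2 D : R, 1 <= D & M * (zeta + 1) / D <= eps / 4.
  pose a := M * (zeta + 1) * (4 / eps).
  have a0 : 0 <= a by rewrite !mulr_ge0 ?invr_ge0 ?(ltW eps0)//; lra.
  exists (a + 1); first lra.
  rewrite ler_pdivrMr; last lra.
  have -> : eps / 4 * (a + 1) = M * (zeta + 1) + eps / 4.
    by rewrite /a; field; rewrite gt_eqF.
  lra.
have D0 : 0 < D by lra.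
(* Below the cutoff the exponent is at most [D], so this error in the base becomes at most
   [eps / 4]. *)
have e20 : 0 < eps / (4 * D) by rewrite divr_gt0// mulr_gt0.
have [d1 d10 H1] := unr_concentration c01 IH e20.
(* Keeps every smaller system below the cutoff in the regime [d1]. *)
pose d2 := d1 / (M + D + 1).
have d20 : 0 < d2 by rewrite divr_gt0//; lra.
(* [delta * C] dominates the Poisson approximation error in [step2]. *)
pose C := M + 2 * M ^+ 2 * (zeta + 1) + 1.
have C0 : 0 < C.
  have : 0 <= 2 * M ^+ 2 * (zeta + 1) by rewrite !mulr_ge0 ?exprn_ge0//; lra.
  rewrite /C; lra.
pose d3 := eps / (2 * C).
have d30 : 0 < d3 by rewrite divr_gt0// mulr_gt0.
have M1 : 0 < M + 1 by lra.
pose delta := Num.min d2 (Num.min d3 (Num.min (M + 1)^-1 1)).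
exists delta; first by rewrite !lt_min d20 d30 ltr01 invr_gt0 M1.
have : delta <= delta by [].
rewrite {2}/delta !le_min => /and4P[dd2 dd3 dM dd1].
move: delta dd2 dd3 dM dd1 => delta dd2 dd3 dM dd1.
move=> Dev Slot w p G V A reg AG Am.
have [w01 wp /andP[p0 pd] _ pV] := reg.
have p1 : p <= 1 by apply: le_trans dd1.
have d0 : 0 <= delta by apply: le_trans pd.
have pVle : p * #|V|%:R <= zeta + 1 by move: pV; rewrite ler_norml; lra.
have pV0 : 0 <= p * #|V|%:R by rewrite mulr_ge0.
have Mp : M * p <= M * delta by rewrite ler_wpM2l.
have Md1 : M * delta <= 1.
  by move: dM; rewrite -div1r ler_pdivlMr// mulrDr mulr1; lra.
have dd1' : delta * (M + D + 1) <= d1 by rewrite -ler_pdivlMr//; lra.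
have dled1 : delta <= d1.
  by apply: le_trans dd1'; rewrite ler_peMr//; lra.
rewrite (Punr_rec wp)//; set b := 1 - e.
have b01 : 0 <= b <= 1 by rewrite /b; lra.
have step1 : `|bernE w (fun x => bernE w (fun y =>
    (1 - (1 - p) ^+ #|unr l (G :\: A)%SET (untouched A V x) y|)
      ^+ nsingly V A x)) - bernE w (fun x => b ^+ nsingly V A x)| <= eps / 2.
  rewrite -bernEB; apply: le_trans (ler_norm_bernE _ _) _ => //.
  (* The first summand covers at most [D] touched slots; beyond [D] the second exceeds 1, which
     bounds the difference trivially. *)
  apply: (@le_trans _ _ (bernE w (fun x =>
      eps / 4 + D^-1 * #|V :\: untouched A V x|%:R))); last first.
    rewrite bernED bernE_cst bernEZ.
    have := bernE_touched w01 wp AG; rewrite Am -/M => HT.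
    have {}HT := le_trans HT (ler_wpM2l M0 pVle).
    have Di : 0 <= D^-1 by rewrite invr_ge0 ltW.
    have {}HT := ler_wpM2l Di HT; move: HD; rewrite mulrC; lra.
  apply: ler_bernE => // x; set n := nsingly V A x.
  have n1 := nsingly_le A V x; rewrite -(ler_nat R) -/n in n1.
  have T0 : 0 <= D^-1 * #|V :\: untouched A V x|%:R.
    by rewrite mulr_ge0// invr_ge0 ltW.
  have X01 y :
      0 <= 1 - (1 - p) ^+ #|unr l (G :\: A)%SET (untouched A V x) y| <= 1.
    rewrite subr_ge0 exprn_ile1 ?gerBl ?exprn_ge0 ?subr_ge0//; lra.
  rewrite -[b ^+ n](bernE_cst w) -bernEB.
  apply: le_trans (ler_norm_bernE _ _) _ => //.
  have [TD|DT] := leP (#|V :\: untouched A V x|%:R : R) D.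
    have reg' : regime d1 w p (G :\: A)%SET (untouched A V x).
      by apply: regime_untouched reg AG TD _ dled1; rewrite Am.
    apply: (@le_trans _ _ (eps / 4)); last by rewrite lerDl.
    have {H1} := H1 _ _ _ _ _ _ reg' => H1.
    apply: (@le_trans _ _ (bernE w (fun y => n%:R *
      `|(1 - p) ^+ #|unr l (G :\: A)%SET (untouched A V x) y| - e|))).
      apply: ler_bernE => // y; apply: le_trans (distX_le _ _ _) _ => //.
      rewrite [in leRHS]distrC ler_wpM2l// le_eqVlt; apply/predU1P; left.
      by congr `|_|; rewrite /b; ring.
    rewrite bernEZ; apply: le_trans (ler_wpM2l _ H1) _ => //.
    have -> : eps / 4 = D * (eps / (4 * D)) by field; rewrite gt_eqF.
    by rewrite ler_wpM2r ?(ltW e20)// (le_trans n1).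
  apply: (@le_trans _ _ (bernE w (fun=> 1))).
    apply: ler_bernE => // y.
    have := X01 y; set X := 1 - _ => /andP[X0 X1].
    have /andP[b0 b1] := b01.
    have : 0 <= X ^+ n <= 1 by rewrite exprn_ge0// exprn_ile1.
    have : 0 <= b ^+ n <= 1 by rewrite exprn_ge0// exprn_ile1.
    by rewrite ler_norml; lra.
  rewrite bernE_cst; apply: (@le_trans _ _ (D^-1 * #|V :\: untouched A V x|%:R)).
    by rewrite mulrC ler_pdivlMr// mul1r ltW.
  by rewrite lerDr divr_ge0 ?(ltW eps0).
have step2 : `|bernE w (fun x => b ^+ nsingly V A x) -
    expR (- (zeta * e)) ^+ m| <= eps / 2.
  rewrite (bernE_exp_nsingly wp)// Am -/M -expRM_natl mulrN -/M.
  have -> : 1 - b = e by rewrite /b opprB addrC subrK.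
  set s := (1 - p) ^+ m.-1.
  have s0 : 0 <= s by rewrite exprn_ge0// subr_ge0.
  have s1 : s <= 1 by rewrite exprn_ile1 ?subr_ge0// gerBl.
  have sM : 1 - s <= M * delta.
    have p01 : 0 <= 1 - p <= 1 by rewrite subr_ge0 p1 gerBl.
    have : `|1 ^+ m.-1 - s| <= m.-1%:R * `|1 - (1 - p)|.
      by apply: distX_le; rewrite ?ler01 ?lexx.
    rewrite expr1n subKr (ger0_norm p0) ger0_norm ?subr_ge0// => sle.
    apply: le_trans sle _; apply: ler_pM => //.
    by rewrite ler_nat leq_pred.
  have Mps0 : 0 <= M * p * s by rewrite !mulr_ge0.
  have Mps : M * p * s <= M * delta.
    by apply: le_trans Mp; rewrite ler_piMr// mulr_ge0.
  set y := e * (M * p * s).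
  have y0 : 0 <= y by rewrite mulr_ge0.
  have yM : y <= M * delta by apply: le_trans Mps; rewrite ler_piMl.
  apply: le_trans (dist_pow1B_expR _ _ _) _.
  - by rewrite y0 (le_trans yM).
  - by rewrite !mulr_ge0.
  have Vy : #|V|%:R * y <= M * (zeta + 1).
    have -> : #|V|%:R * y = (e * s) * (M * (p * #|V|%:R)) by rewrite /y; ring.
    apply: (@le_trans _ _ (M * (p * #|V|%:R))); last by rewrite ler_wpM2l.
    by rewrite ler_piMl ?mulr_ge0// mulr_ile1.
  have Vyy : #|V|%:R * y * y <= M * (zeta + 1) * (M * delta).
    by rewrite ler_pM// mulr_ge0.
  have Vd : `|#|V|%:R * y - M * (zeta * e)| <=
      M * (delta + (zeta + 1) * (M * delta)).
    have -> : #|V|%:R * y - M * (zeta * e) = e * (M *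
        ((p * #|V|%:R - zeta) - p * #|V|%:R * (1 - s))) by rewrite /y; ring.
    rewrite normrM (ger0_norm e0); apply: le_trans (ler_piMl _ e1) _ => //.
    rewrite normrM (ger0_norm M0) ler_wpM2l//.
    apply: le_trans (ler_normB _ _) _; rewrite lerD// normrM (ger0_norm pV0).
    by rewrite ger0_norm ?subr_ge0// ler_pM// subr_ge0.
  have : delta * C <= eps / 2.
    have -> : eps / 2 = d3 * C by rewrite /d3; field; rewrite gt_eqF.
    by rewrite ler_wpM2r// ltW.
  have -> : delta * C = M * (zeta + 1) * (M * delta) +
      M * (delta + (zeta + 1) * (M * delta)) + delta by rewrite /C; ring.
  lra.
rewrite -(subrKA (bernE w (fun x => b ^+ nsingly V A x))).
apply: le_trans (ler_normD _ _) _; lra.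
Qed.

End Limit.

(** * Reduction of SIC on the whole frame to peeling within one group *)

Section Frame.
Variables (K r : nat) (N : 'I_r -> nat) (grp : 'I_K -> 'I_r).
Variable x : frame K N.
Hypothesis x_own : forall k t, x (k, t) -> grp k = tag t.

Definition own_slots (i : 'I_r) : {set slot N} := [set t | tag t == i]%SET.

(** The slots used in the first [n] stages have subframe index below [n], hence below [i], where
    group [i] is silent. *)
Lemma resolved_before l n (i : 'I_r) k : (n <= i)%N -> k \in group grp i ->
  k \notin resolved x l n.
Proof.
move=> + kG; elim: n => [|n IHn] ni; first by rewrite inE.
rewrite /=; move: (resolved x l n) (IHn (ltnW ni)) => {IHn} D kD.
elim: l => //= l IHl.
rewrite inE negb_or IHl/= inE; apply/exists_inP => -[t].
rewrite inE => tn /eqP/setP/(_ k); rewrite !inE eqxx => /andP[_ /x_own].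
move: kG; rewrite inE => /eqP -> it; move: tn; rewrite -it.
by rewrite leqNgt ni.
Qed.

(** The receiver also uses earlier subframes and earlier resolutions, but neither affects group [i]:
    its devices appear only in slots of subframe [i], and those slots carry no other device. *)
Lemma unresolvedE l i :
  unresolved grp x l i = unr l (group grp i) (own_slots i) x.
Proof.
rewrite /unresolved /=.
have : (group grp i :\: resolved x l i)%SET = group grp i.
  apply/finset.setDidPl; rewrite disjoint_subset; apply/fintype.subsetP => k kG.
  exact: resolved_before kG.
move: (resolved x l i) => D GD.
elim: l => [|l IHl] //=; rewrite -{}IHl; move: (iter l _ D) => {GD}D.
apply/setP => k; rewrite !inE negb_or -!andbA andbC -!andbA.
have [kD|kD] := boolP (k \in D); rewrite /= ?andbF//=.
have [/eqP gk|//] := boolP (grp k == i); rewrite /= ?andbF ?andbT//.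
apply/idP/forall_inP => [/exists_inPn H t|H].
  rewrite inE => /eqP ti; apply/implyP => xkt.
  have : t \in [set t0 : slot N | ((tag t0 : 'I_r) <= i)%N]%SET.
    by rewrite inE ti.
  move=> /H; apply: contraR => /exists_inPn H'; apply/eqP/setP => k'.
  rewrite !inE; have [->|k'k] := eqVneq k' k; first by rewrite kD xkt.
  apply/negP => /andP[k'D xk't].
  have := H' k'; rewrite k'k xk't !inE k'D (x_own xk't) ti eqxx.
  by move=> /(_ isT).
apply/exists_inPn => t; rewrite inE => ti; apply/negP => /eqP/setP kt.
have := kt k; rewrite !inE eqxx => /andP[_ xkt].
have tV : t \in own_slots i by rewrite inE -(x_own xkt) gk.
have /exists_inP[k'] := implyP (H t tV) xkt.
rewrite !inE => /andP[k'D _] /andP[k'k xk't].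
by have := kt k'; rewrite !inE k'D xk't (negbTE k'k).
Qed.

End Frame.

(** * Frame expectations as survival probabilities of peeling *)

Section FrameExpectation.
Variables (R : realType) (K r : nat) (N : 'I_r -> nat) (g : 'I_r -> R).
Variable (grp : 'I_K -> 'I_r).

Definition tx_weight (e : 'I_K * slot N) : R := tx_prob g grp e.1 (tag e.2).

(** A frame with a transmission outside the sender's own subframe has probability 0. *)
Lemma expect_own (X Y : frame K N -> R) :
  (forall x : frame K N,
    (forall k t, x (k, t) -> grp k = tag t) -> X x = Y x) ->
  expect g grp X = bernE tx_weight Y.
Proof.
move=> XY; apply: eq_bigr => x _.
have [x_own|] := pselect (forall k t, x (k, t) -> grp k = tag t).
  by rewrite XY.
move=> nx; suff f0 : frame_prob g grp x = 0.
  by rewrite f0 -[bern _ _]/(frame_prob g grp x) f0 !mul0r.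
have [[k t] /= [xkt kt]] : exists e, x e /\ grp e.1 <> tag e.2.
  by apply: contrapT => /forallNP H; apply: nx => k t xkt;
    apply: contrapT => kt; exact: (H (k, t)).
rewrite /frame_prob (bigD1 (k, t))//= xkt /tx_prob.
by move/eqP/negbTE: kt => ->; rewrite mul0r.
Qed.

Lemma unresolved_probE l k :
  unresolved_prob N g grp l k =
  Punr tx_weight (group grp (grp k)) (own_slots N (grp k)) l [set k]%SET.
Proof.
apply: expect_own => x x_own.
by rewrite unresolvedE// finset.sub1set.
Qed.

Lemma unresolved_fractionE l i :
  unresolved_fraction N g grp l i =
  (\sum_(k in group grp i) unresolved_prob N g grp l k) / #|group grp i|%:R.
Proof.
rewrite mulrC /unresolved_fraction.
rewrite (expect_own (Y := fun x => (#|group grp i|%:R)^-1 *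
   #|unr l (group grp i) (own_slots N i) x|%:R)); last first.
  by move=> x x_own; rewrite unresolvedE// mulrC.
rewrite bernEZ; congr (_ * _).
under bernE_eq do rewrite card_unr.
rewrite bernE_sum; apply: eq_bigr => k; rewrite inE => /eqP ki.
by rewrite unresolved_probE ki.
Qed.

Lemma card_own_slots i : #|own_slots N i| = N i.
Proof.
rewrite -[RHS]card_ord -cardsT.
rewrite -(card_imset _ (f := Tagged (fun s => 'I_(N s)))); last first.
  by move=> t u /eqP; rewrite eq_Tagged => /eqP.
apply: eq_card => -[s t]; rewrite inE /=.
apply/eqP/imsetP => [si|[u _ e]]; last exact: (congr1 tag e).
by subst s; exists t.
Qed.

End FrameExpectation.

(** * Edge-perspective generating function of a Poisson law *)

Lemma edge_gf_poisson (R : realType) (s x : R) : 0 < s ->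
  edge_gf (poisson_pmf s) x = expR (s * (x - 1)).
Proof.
move=> s0.
have H z : limn (series (fun d => d%:R * poisson_pmf s d * z ^+ d.-1)) =
    s * expR (- s) * expR (s * z).
  (* Dropping the null term [d = 0] and cancelling [d] against the factorial leaves an exponential
     series; the normalising mean is the case [z = 1]. *)
  apply: cvg_lim => //; rewrite -cvg_shiftS.
  suff -> : (fun n => series (fun d => d%:R * poisson_pmf s d * z ^+ d.-1) n.+1)
      = (fun n => s * expR (- s) * series (exp_coeff (s * z)) n).
    by apply: cvgMl_tmp; exact: is_cvg_series_exp_coeff.
  apply/funext => n; rewrite /series /= big_nat_recl// !mul0r add0r mulr_sumr.
  apply: eq_bigr => d _; rewrite /poisson_pmf /exp_coeff s0 /= factS natrM exprS
    exprMn.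
  by field; rewrite nat1r !pnatr_eq0 -lt0n fact_gt0.
rewrite /edge_gf H.
have -> : (fun d => d%:R * poisson_pmf s d) =
    (fun d => d%:R * poisson_pmf s d * 1 ^+ d.-1).
  by apply/funext => d; rewrite expr1n mulr1.
rewrite H mulr1 -mulf_div mulfV ?mul1r; last first.
  by rewrite mulf_neq0 ?gt_eqF ?expR_gt0.
by rewrite -expRN -expRD mulrBr mulr1.
Qed.

Local Open Scope classical_set_scope.

(** * Density evolution and the large-system limit *)

Section LargeSystem.
Variables (R : realType) (r : nat) (alpha nu g : 'I_r -> R).
Variables (grp : forall K : nat, 'I_K -> 'I_r) (N : nat -> 'I_r -> nat).
Hypothesis (alpha_gt0 : forall i, 0 < alpha i).
Hypothesis (nu_gt0 : forall s, 0 < nu s).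
Hypothesis (g_gt0 : forall i, 0 < g i).
Hypothesis (g_le : forall i,
  \forall K \near \oo, g i <= #|group (@grp K) i|%:R).
Hypothesis (group_size :
  forall K i, `| #|group (@grp K) i|%:R - alpha i * K%:R | < 1).
Hypothesis (subframe_size : forall K s, `| (N K s)%:R - nu s * K%:R | < 1).
Variable i : 'I_r.

Let zeta := g i * nu i / alpha i.

Lemma zeta_gt0 : 0 < zeta.
Proof. by rewrite divr_gt0// mulr_gt0. Qed.

Lemma qS l : q alpha nu g i l.+1 =
  expR (- (zeta * expR (- (g i * q alpha nu g i l)))).
Proof.
rewrite /= /Lambda /Omega !edge_gf_poisson//; last exact: zeta_gt0.
move: (q _ _ _ _ _) => c.
have e (x : R) : 1 - x - 1 = - x by rewrite addrAC subrr add0r.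
by rewrite !e !mulrN.
Qed.

Lemma q_itv l : 0 <= q alpha nu g i l <= 1.
Proof.
case: l => [|l]; first by rewrite ler01 lexx.
rewrite qS expR_ge0 -expR0 ler_expR oppr_le0 mulr_ge0 ?expR_ge0//.
exact/ltW/zeta_gt0.
Qed.

(** The recursion map is increasing and [q 1 <= q 0 = 1], so the sequence decreases and is bounded
    below by 0. *)
Lemma q_cvg : cvgn (q alpha nu g i).
Proof.
apply: nonincreasing_is_cvgn; last first.
  by exists 0 => _ [l _ <-]; have /andP[] := q_itv l.
apply/nonincreasing_seqP; elim=> [|l IHl]; first by have /andP[] := q_itv 1.
rewrite qS [leRHS]qS ler_expR lerN2 ler_pM2l ?zeta_gt0// ler_expR lerN2.
by rewrite ler_pM2l.
Qed.

Lemma unr_cvg_q l : unr_cvg (g i) zeta l (q alpha nu g i l).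
Proof.
elim: l => [|l IHl].
  move=> m eps eps0; exists 1 => // Dev Slot w p G V A _ AG _.
  rewrite expr1n /Punr /= AG bernE_cst subrr normr0; exact: ltW.
rewrite qS; apply: unr_cvgS (q_itv l) IHl; apply: ltW => //.
exact: zeta_gt0.
Qed.

(** Here [p * #|G| = g i] exactly; the error on the slot side comes only from rounding and is of
    order one over the group size. *)
Lemma regime_frame (delta : R) : 0 < delta ->
  \forall K \near \oo, regime (g i) zeta delta
    (tx_weight (N := N K) g (@grp K)) (g i / #|group (@grp K) i|%:R)
    (group (@grp K) i) (own_slots (N K) i).
Proof.
move=> d0; have a0 := alpha_gt0 i; have n0 := nu_gt0 i; have g0 := g_gt0 i.
(* A group size of at least [B] makes both [p] and the slot-side error at most [delta]. *)
pose B := (g i * (alpha i + nu i) / alpha i + g i) / delta.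
have B0 : 0 < g i * (alpha i + nu i) / alpha i.
  by rewrite divr_gt0// mulr_gt0// addr_gt0.
(* All groups are treated at once because every edge weight of the frame must lie between 0 and
   1. *)
have gK0 : \forall K \near \oo, forall s, g s <= #|group (@grp K) s|%:R.
  exact: filter_forall.
have KB0 := nbhs_infty_ger ((B + 1) / alpha i).
apply: filterS2 gK0 KB0 => K gK KB.
set n : R := #|group (@grp K) i|%:R.
have ngt0 s : 0 < #|group (@grp K) s|%:R :> R by apply: lt_le_trans (gK s).
have np : 0 < n := ngt0 i.
have nB : B <= n.
  move: KB; rewrite ler_pdivrMr// mulrC => KB.
  by have := group_size K i; rewrite ltr_norml -/n; lra.
have nd : g i * (alpha i + nu i) / alpha i + g i <= delta * n.
  by move: nB; rewrite /B ler_pdivrMr// (mulrC n).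
split.
- move=> [k t]; rewrite /tx_weight /tx_prob /=; case: ifP => _.
    by rewrite divr_ge0 ?(ltW (g_gt0 _))//= ler_pdivrMr// mul1r.
  by rewrite lexx ler01.
- move=> k t; rewrite !inE => /eqP kG /eqP tV.
  by rewrite /tx_weight /tx_prob /= kG tV eqxx.
- rewrite divr_ge0 ?(ltW g0) ?ler0n//= ler_pdivrMr ?np//.
  by apply: le_trans nd; rewrite lerDr ltW.
- by rewrite divfK ?gt_eqF ?np// subrr normr0 ltW.
rewrite card_own_slots -/n.
(* The difference is rewritten in terms of the two rounding errors, each below 1 in absolute
   value. *)
have -> : g i / n * (N K i)%:R - zeta = g i / (n * alpha i) *
    (alpha i * ((N K i)%:R - nu i * K%:R) - nu i * (n - alpha i * K%:R)).
  by rewrite /zeta; field; rewrite !gt_eqF ?np.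
have c0 : 0 <= g i / (n * alpha i).
  by rewrite divr_ge0 ?(ltW g0)// mulr_ge0// ltW.
rewrite normrM (ger0_norm c0).
apply: (@le_trans _ _ (g i / (n * alpha i) * (alpha i + nu i))).
  rewrite ler_wpM2l// (le_trans (ler_normB _ _))// !normrM.
  rewrite (gtr0_norm a0) (gtr0_norm n0).
  rewrite lerD// ler_piMr ?(ltW a0) ?(ltW n0)//.
    exact/ltW/subframe_size.
  exact/ltW/group_size.
have -> : g i / (n * alpha i) * (alpha i + nu i) =
    g i * (alpha i + nu i) / alpha i / n.
  by field; rewrite !gt_eqF.
by rewrite ler_pdivrMr ?np//; apply: le_trans nd; rewrite lerDl ltW.
Qed.

(** Uniformity over the devices of the group serves both the average and an arbitrary sequence of
    devices. *)
Lemma unresolved_prob_near l (eps : R) : 0 < eps ->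
  \forall K \near \oo, (0 < #|group (@grp K) i|)%N /\
    forall k, grp k = i ->
      `|unresolved_prob (N K) g (@grp K) l k - q alpha nu g i l| <= eps.
Proof.
move=> eps0; have [delta d0 H] := @unr_cvg_q l 1%N _ eps0.
apply: filterS2 (g_le i) (regime_frame d0) => K gK reg; split.
  by rewrite -(ltr_nat R); apply: lt_le_trans gK.
move=> k ki; rewrite unresolved_probE ki -[q _ _ _ _ _]expr1.
by apply: H reg _ (cards1 k); rewrite finset.sub1set inE ki.
Qed.

Lemma unresolved_fraction_cvg l :
  unresolved_fraction (N K) g (@grp K) l i @[K --> \oo] --> q alpha nu g i l.
Proof.
apply/cvgrPdist_le => eps eps0; have := unresolved_prob_near l eps0.
apply: filterS => K [G0 H]; rewrite distrC unresolved_fractionE.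
set G := group _ _; have n0 : 0 < #|G|%:R :> R by rewrite ltr0n.
set ql := q _ _ _ _ l.
have -> : (\sum_(k in G) unresolved_prob (N K) g (@grp K) l k) / #|G|%:R - ql =
    (\sum_(k in G) (unresolved_prob (N K) g (@grp K) l k - ql)) / #|G|%:R.
  by rewrite sumrB sumr_const -mulr_natr; field; rewrite gt_eqF.
rewrite normrM normfV (gtr0_norm n0) ler_pdivrMr//.
apply: le_trans (ler_norm_sum _ _ _) _.
rewrite mulr_natr -sumr_const; apply: ler_sum => k.
by rewrite inE => /eqP; exact: H.
Qed.

Lemma epsilon_iterE : epsilon_iter N g grp i = q alpha nu g i.
Proof.
by apply/funext => l; apply: cvg_lim => //; exact: unresolved_fraction_cvg.
Qed.

End LargeSystem.

(** Convergence is asserted along with the equality so that each [limn] is a genuine limit. The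
    chosen device lives in ['I_K.+1] because ['I_0] is empty. *)
Theorem proposition1 (R : realType) (r : nat) (alpha nu g : 'I_r -> R)
    (grp : forall K : nat, 'I_K -> 'I_r) (N : nat -> 'I_r -> nat)
    (alpha_gt0 : forall i, 0 < alpha i)
    (alpha_lt1 : forall i, alpha i < 1)
    (sum_alpha : \sum_i alpha i = 1)
    (nu_gt0 : forall s, 0 < nu s)
    (g_gt0 : forall i, 0 < g i)
    (g_le : forall i, \forall K \near \oo, g i <= #|group (grp K) i|%:R)
    (group_size : forall K i, `| #|group (grp K) i|%:R - alpha i * K%:R | < 1)
    (subframe_size : forall K s, `| (N K s)%:R - nu s * K%:R | < 1)
    (i : 'I_r) :
  [/\ forall l, cvgn (fun K => unresolved_fraction (N K) g (grp K) l i),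
      forall (l : nat) (k : forall K : nat, 'I_K.+1),
        (\forall K \near \oo, grp K.+1 (k K) = i) ->
        unresolved_prob (N K.+1) g (grp K.+1) l (k K) @[K --> \oo] -->
          epsilon_iter N g grp i l,
      cvgn (epsilon_iter N g grp i),
      cvgn (q alpha nu g i) &
      epsilon N g grp i = limn (q alpha nu g i)].
Proof.
have frac_cvg l : unresolved_fraction (N K) g (grp K) l i @[K --> \oo] -->
    q alpha nu g i l by exact: unresolved_fraction_cvg.
have q_cvgn : cvgn (q alpha nu g i) by exact: q_cvg.
rewrite /epsilon (epsilon_iterE alpha_gt0 nu_gt0 g_gt0 g_le group_size
  subframe_size i).
split=> // [l|l k ki]; first by apply/cvg_ex; eexists; exact: frac_cvg.
apply/cvgrPdist_le => eps eps0.
have [K0 _ HK0] := unresolved_prob_near alpha_gt0 nu_gt0 g_gt0 g_le group_size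
  subframe_size i l eps0.
near=> K.
rewrite distrC; have [|_ HK] := HK0 K.+1.
  by rewrite /=; apply: leqW; near: K; exact: nbhs_infty_ge.
by apply: HK; near: K.
Unshelve. all: by end_near.
Qed.
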